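(* Let $\chi:\mathbb{R}^+\to\mathbb{R}$ be a kernel, let $f:\mathbb{R}^+\to\mathbb{R}$ be a bounded measurable function with a non-removable jump discontinuity at $t\in\mathbb{R}^{+}$, and let $\alpha \in \mathbb{R}$. Then the following are equivalent: (i) $\displaystyle \lim_{\substack{w \rightarrow \infty\\ w\log t\in \mathbb{Z}}}(I_w^{\chi}f)(t)=[\chi(1)+\alpha] f(t+0)+[1-\alpha-\chi(1)]f(t-0)$; (ii) $\psi_{\chi}^{-}(1)=\alpha$; (iii) $\psi_{\chi}^{+}(1)=1-\alpha-\chi(1)$.
   Context: $\mathbb{R}^+$ denotes the positive real numbers. A function $\chi:\mathbb{R}^+\to\mathbb{R}$ is called a kernel if: (i) $\chi\in L^1(\mathbb{R}^+)$ and $\chi$ is bounded on $[1/e,e]$; (ii) $\sum_{k=-\infty}^{+\infty}\chi(e^{-k}u)=1$ for every $u\in\mathbb{R}^+$; (iii) for some $\nu>0$, $\sup_{u\in\mathbb{R}^+}\sum_{k=-\infty}^{+\infty}|\chi(e^{-k}u)|\,|k-\log u|^{\nu}<+\infty$. For $w>0$ and bounded measurable $f:\mathbb{R}^+\to\mathbb{R}$, the Kantorovich exponential sampling series is \[(I_{w}^{\chi}f)(x)= \sum_{k= - \infty}^{+\infty} \chi(e^{-k} x^{w})\, w \int_{k/w}^{(k+1)/w} f(e^{u})\, du,\quad x\in\mathbb{R}^+.\] The one-sided limits are $f(t+0):=\lim_{y\to0^+}f(t+y)$ and $f(t-0):=\lim_{y\to0^+}f(t-y)$; $f$ has a non-removable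 jump discontinuity at $t$ if both exist, are finite, and are different. For $u\in\mathbb{R}^+$, $\psi_\chi^+(u):=\sum_{k\in\mathbb{Z},\,k<\log u}\chi(ue^{-k})$ and $\psi_\chi^-(u):=\sum_{k\in\mathbb{Z},\,k>\log u}\chi(ue^{-k})$. The limit in (i) is taken as $w\to\infty$ through those $w>0$ with $w\log t\in\mathbb{Z}$. *)

(* Defs.v *)
From HB Require Import structures.
From mathcomp Require Import all_boot all_order all_algebra.
From mathcomp Require Import all_classical all_reals all_analysis.

Set Implicit Arguments.
Unset Strict Implicit.
Unset Printing Implicit Defensive.

Import Order.TTheory GRing.Theory Num.Theory.
Import numFieldNormedType.Exports.

Local Open Scope classical_set_scope.
Local Open Scope ring_scope.

(* A function R^+ -> R is represented by a function R -> R whose values outside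
   `]0, +oo[ are never used. *)

(* R with the Lebesgue (i.e. completed Borel) sigma-algebra, on which
   completed_lebesgue_measure is defined. *)
Definition lebesgueType (R : realType) :=
  caratheodory_type ((@wlength R idfun)^*)%mu.

Definition lebesgue_measurable_fun (R : realType) (D : set R) (f : R -> R) :=
  measurable_fun (D : set (lebesgueType R)) (f : lebesgueType R -> R).

(* The two halves of the series converge separately. *)
Definition bisum_cvg (R : realType) (a : int -> R) : Prop :=
  cvgn (series (fun n : nat => a n%:Z)) /\
  cvgn (series (fun n : nat => a (- n.+1%:Z))).

Definition bisum (R : realType) (a : int -> R) : R :=
  limn (series (fun n : nat => a n%:Z)) +
  limn (series (fun n : nat => a (- n.+1%:Z))).

(* The sums of kernel_moment have nonnegative terms and are taken in \bar R, so
   their convergence is part of the finiteness of the supremum. *)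
Record is_kernel (R : realType) (chi : R -> R) : Prop := IsKernel {
  kernel_L1 :
    completed_lebesgue_measure.-integrable `]0, +oo[ (EFin \o chi) ;
  kernel_bounded : [bounded chi u | u in `[(expR 1)^-1, expR 1]] ;
  kernel_sum1 : forall u : R, 0 < u ->
    bisum_cvg (fun k : int => chi (expR (- k%:~R) * u)) /\
    bisum (fun k : int => chi (expR (- k%:~R) * u)) = 1 ;
  kernel_moment : exists2 nu : R, 0 < nu &
    (ereal_sup [set \esum_(k in [set: int])
        (`|chi (expR (- k%:~R) * u)| * `|k%:~R - ln u| `^ nu)%:E
      | u in `]0%R, +oo[ ] < +oo)%E }.

Definition kantorovich (R : realType) (chi : R -> R) (w : R) (f : R -> R)
    (x : R) : R :=
  bisum (fun k : int => chi (expR (- k%:~R) * x `^ w) *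
    (w * \int[@completed_lebesgue_measure R]_(u in `[k%:~R / w, (k + 1)%:~R / w])
            f (expR u))).

Definition right_limit (R : realType) (f : R -> R) (t : R) : R :=
  lim (f (t + y) @[y --> 0^'+]).

Definition left_limit (R : realType) (f : R -> R) (t : R) : R :=
  lim (f (t - y) @[y --> 0^'+]).

Definition jump_discontinuity (R : realType) (f : R -> R) (t : R) : Prop :=
  [/\ cvg (f (t + y) @[y --> 0^'+]), cvg (f (t - y) @[y --> 0^'+])
    & right_limit f t <> left_limit f t].

Definition psi_plus (R : realType) (chi : R -> R) (u : R) : R :=
  bisum (fun k : int =>
    if k%:~R < ln u then chi (u * expR (- k%:~R)) else 0).

Definition psi_minus (R : realType) (chi : R -> R) (u : R) : R :=
  bisum (fun k : int =>
    if ln u < k%:~R then chi (u * expR (- k%:~R)) else 0).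

(* Main.v *)
(* When w * ln t is an integer m, the substitution k = m + j turns the series into
   the sum over j of chi(e^-j) times the average of f o exp over the window
   [ln t + j/w, ln t + (j+1)/w].  As w grows, this average tends to f(t+0) for
   j >= 0 and to f(t-0) for j < 0, so by dominated convergence (the moment
   condition makes chi(e^-j) absolutely summable) the series tends to
   (chi 1 + psi^-(1)) f(t+0) + psi^+(1) f(t-0).  Since chi 1 + psi^-(1) + psi^+(1) = 1,
   this equals the prescribed limit iff (psi^-(1) - alpha) (f(t+0) - f(t-0)) = 0. *)
Require Import Defs.
From HB Require Import structures.
From mathcomp Require Import all_boot all_order all_algebra.
From mathcomp Require Import all_classical all_reals all_analysis.
From mathcomp Require Import measurable_realfun.
From mathcomp Require Import zify ring lra.
Set Implicit Arguments.
Unset Strict Implicit.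
Unset Printing Implicit Defensive.
Import Order.TTheory GRing.Theory Num.Theory.
Import numFieldNormedType.Exports.
Local Open Scope classical_set_scope.
Local Open Scope ring_scope.

(** * Comparison and bounds for integrals over intervals *)

Section integral_monotone.
Import HBNNSimple.

(* No measurability is assumed: the integral of an arbitrary nonnegative function
   is a supremum over the simple functions below it. *)
Lemma le_integral_pointwise d (T : measurableType d) (R : realType)
    (mu : {measure set T -> \bar R}) (D : set T) (f g : T -> \bar R) :
  (forall x, D x -> (f x <= g x)%E) ->
  (\int[mu]_(x in D) f x <= \int[mu]_(x in D) g x)%E.
Proof.
move=> fg.
have nn_le (f1 f2 : T -> \bar R) : (forall x, f1 x <= f2 x)%E ->
    (ereal_sup [set sintegral mu h | h in
      [set h : {nnsfun T >-> R} | forall x, ((h x)%:E <= f1 x)%E]] <=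
     ereal_sup [set sintegral mu h | h in
      [set h : {nnsfun T >-> R} | forall x, ((h x)%:E <= f2 x)%E]])%E.
  move=> f12; apply: ereal_sup_le => _ [h /= hf1 <-].
  by exists h => // x; exact: le_trans (f12 x).
have fgD x : ((f \_ D) x <= (g \_ D) x)%E.
  by rewrite /patch; case: ifPn => // /set_mem /fg.
rewrite /integral; apply: leeB; apply: nn_le => x.
  by rewrite !funeposE ge_max !le_max fgD lexx orbT.
by rewrite !funenegE ge_max !le_max leeN2 fgD lexx orbT.
Qed.

End integral_monotone.

Section interval_bounds.
Variable R : realType.
Local Notation mu := (@completed_lebesgue_measure R).

Lemma measurable_itv_lebesgueType (i : interval R) :
  measurable ([set` i] : set (lebesgueType R)).
Proof. apply: sub_caratheodory; exact: measurable_itv. Qed.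

(** A singleton is null, so the integrand is almost everywhere [U]. It serves as comparison function
    below, with [M] absorbing the uncontrolled value at [c]. *)
Lemma integral_itv_cst_off_point (a b c M U : R) : a < b ->
  (\int[mu]_(x in `[a, b]) (if (x : R) == c then M else U)%:E = (U * (b - a))%:E)%E.
Proof.
move=> ab.
have mD := measurable_itv_lebesgueType `[a, b].
have mc : measurable ([set c] : set (lebesgueType R)).
  by rewrite -set_itv1; exact: measurable_itv_lebesgueType.
rewrite (@ae_eq_integral _ _ _ mu _ (cst U%:E)) //.
- rewrite integral_cst//.
  transitivity (U%:E * (@lebesgue_measure R) `[a, b])%E; first by [].
  by rewrite lebesgue_measure_itv /= lte_fin ab.
- apply/measurable_EFinP; apply: measurable_fun_if => //.
  apply: (measurable_fun_bool true).
  rewrite [X in _ `&` X](_ : _ = [set c]); first exact: measurableI.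
  by apply/seteqP; split=> x /= /eqP.
- exists [set c]; split => //; first exact: (@lebesgue_measure_set1 R c).
  move=> x /= /not_implyP[_]; apply: contra_notP => /eqP xc.
  by rewrite (negbTE xc).
Qed.

(* The exceptional point [c] will be [ln t]: it is an endpoint of the windows
   [j = -1, 0], and nothing is known about [f t]. *)
Lemma Rintegral_itv_bounds (a b c M l U : R) (g : R -> R) : a < b ->
  (forall x : R, x \in `[a, b] -> `|g x| <= M) ->
  (forall x : R, x \in `[a, b] -> x != c -> l <= g x <= U) ->
  l * (b - a) <= \int[mu]_(x in `[a, b]) g x <= U * (b - a).
Proof.
move=> ab gM glU.
have lo : ((l * (b - a))%:E <= \int[mu]_(x in `[a, b]) (g x)%:E)%E.
  rewrite -(integral_itv_cst_off_point c (- M) l ab).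
  apply: le_integral_pointwise => x /= xab; rewrite lee_fin.
  case: eqP => [_|/eqP xc]; last by have /andP[] := glU x xab xc.
  by have := gM x xab; rewrite ler_norml => /andP[].
have hi : (\int[mu]_(x in `[a, b]) (g x)%:E <= (U * (b - a))%:E)%E.
  rewrite -(integral_itv_cst_off_point c M U ab).
  apply: le_integral_pointwise => x /= xab; rewrite lee_fin.
  case: eqP => [_|/eqP xc]; last by have /andP[] := glU x xab xc.
  by have := gM x xab; rewrite ler_norml => /andP[].
(* Both bounds are finite, so the extended integral is finite and taking its real part loses
   nothing. *)
rewrite /Rintegral; move: lo hi; case: (integral _ _ _) => [r| |] //=.
by rewrite !lee_fin => -> ->.
Qed.
End interval_bounds.

(** * Weighted series and dominated convergence *)

Section weighted_series.
Variable R : realType.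
Implicit Type b : nat -> R.

Lemma normed_series_weighted b (g : nat -> R) :
  [normed series (fun n => b n * g n)] = series (fun n => `|b n| * `|g n|).
Proof. by apply/funext => n /=; apply: eq_bigr => k _; rewrite normrM. Qed.

Lemma cvg_series_weighted b (g : nat -> R) (M : R) :
  cvgn (series (fun n => `|b n|)) -> (forall n, `|g n| <= M) ->
  cvgn (series (fun n => `|b n| * `|g n|)) /\
  cvgn (series (fun n => b n * g n)).
Proof.
move=> cb gM.
have cbg : cvgn (series (fun n => `|b n| * `|g n|)).
  apply: (@series_le_cvg _ _ (fun n => M * `|b n|)) => [n|n|n|].
  - by rewrite mulr_ge0.
  - by rewrite mulr_ge0// (le_trans _ (gM n)).
  - by rewrite mulrC ler_wpM2r.
  - exact: (@is_cvg_seriesZ _ _ M cb).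
by split=> //; apply: normed_cvg; rewrite normed_series_weighted.
Qed.

(** The first [N] terms are kept as they are, and in the tail each [|g n|] is replaced by [M]. *)
Lemma weighted_series_le b (g : nat -> R) (M : R) N :
  cvgn (series (fun n => `|b n|)) -> (forall n, `|g n| <= M) ->
  `|limn (series (fun n => b n * g n))| <=
    series (fun n => `|b n| * `|g n|) N
    + M * (limn (series (fun n => `|b n|)) - series (fun n => `|b n|) N).
Proof.
move=> cb gM; have [cn _] := cvg_series_weighted cb gM.
have M0 : 0 <= M by exact: le_trans (gM 0%N).
apply: (@le_trans _ _ (limn (series (fun n => `|b n| * `|g n|)))).
  rewrite -normed_series_weighted; apply: lim_series_norm.
  by rewrite normed_series_weighted.
apply: limr_le => //; exists N => // n /= Nn.
rewrite -lerBlDl (@sub_series_geq _ _ N n)//.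
apply: (@le_trans _ _ (M * (series (fun n => `|b n|) n - series (fun n => `|b n|) N))).
  rewrite (@sub_series_geq _ _ N n)// mulr_sumr; apply: ler_sum => i _.
  by rewrite mulrC ler_wpM2r.
rewrite ler_wpM2l// lerD2r; apply: nondecreasing_cvgn_le => //.
exact: nondecreasing_series.
Qed.

(** Tannery's theorem along a filter: [N] is chosen so that the tail of [b] is small uniformly in
    [w], and the remaining finite sum tends to 0 term by term. *)
Lemma dominated_cvg_series (T : Type) (F : set_system T) (FF : Filter F) b
    (A : T -> nat -> R) (c M : R) :
  cvgn (series (fun n => `|b n|)) ->
  (\forall w \near F, forall n, `|A w n| <= M) ->
  (forall n, A w n @[w --> F] --> c) ->
  limn (series (fun n => b n * A w n)) @[w --> F] --> c * limn (series b).
Proof.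
move=> cb AM Ac.
have cb1 : cvgn (series b) by exact: normed_cvg.
(* [K] bounds [|c - A w n|]; the absolute values and the [+ 1] make it positive, so that [e / 2] can
   be divided by it. *)
pose K := `|M| + `|c| + 1.
have K0 : 0 < K by rewrite ltr_wpDl// addr_ge0.
apply/cvgrPdist_le => e e0.
have eK : 0 < e / 2 / K by rewrite !divr_gt0.
have [N _ /(_ N (leqnn N))] := (cvgrPdist_le _ _).1 cb _ eK.
set B := limn _ => /= BN.
have S0 : series (fun n => `|b n| * `|c - A w n|) N @[w --> F] --> 0.
  have -> : 0 = \sum_(0 <= i < N) (`|b i| * `|c - c|).
    by rewrite subrr normr0 big1// => i _; rewrite mulr0.
  apply: cvg_big => [|i _]; first exact: add_continuous.
  by apply: cvgMl_tmp; apply: cvg_norm; apply: cvgB => //; exact: cvg_cst.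
move/cvgrPdist_le : S0 => /(_ _ (divr_gt0 e0 (ltr0Sn R 1))) S0.
near=> w.
have AwM : forall n, `|A w n| <= M by near: w.
have cAK n : `|c - A w n| <= K.
  rewrite (le_trans (ler_normB _ _))// /K.
  by have := AwM n; have := ler_norm M; lra.
have [_ cbA] := cvg_series_weighted cb AwM.
have -> : c * limn (series b) - limn (series (fun n => b n * A w n)) =
    limn (series (fun n => b n * (c - A w n))).
  have <- : limn (series (c *: b)) = c * limn (series b) by rewrite lim_seriesZ.
  rewrite -lim_seriesB//; last exact: is_cvg_seriesZ.
  by congr (limn (series _)); apply/funext => n /=; rewrite mulrBr mulrC.
rewrite (le_trans (weighted_series_le N cb cAK))// (splitr e) lerD//.
  have : `|0 - series (fun n => `|b n| * `|c - A w n|) N| <= e / 2 by near: w.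
  by rewrite sub0r normrN; apply: le_trans; exact: ler_norm.
by rewrite -ler_pdivlMl// mulrC (le_trans (ler_norm _)).
Unshelve. all: by end_near. Qed.
End weighted_series.

(** * Translation invariance of two-sided sums *)

Section bilateral_sums.
Variable R : realType.

Lemma cvg_series_behead (u : nat -> R) (l : R) :
  (series u @ \oo --> l) <-> (series (fun n => u n.+1) @ \oo --> l - u 0%N).
Proof.
have E : (fun n => series u n.+1) = (fun n => u 0%N + series (fun n => u n.+1) n).
  by apply/funext => n; rewrite /series /= big_nat_recl.
rewrite -(cvg_shiftS (series u)) /= E; split=> h.
  rewrite (_ : series _ = fun n => (u 0%N + series (fun n => u n.+1) n) - u 0%N).
    by apply: cvgB => //; exact: cvg_cst.
  by apply/funext => n; rewrite addrC addKr.
rewrite -(subrK (u 0%N) l) addrC; apply: cvgD => //; exact: cvg_cst.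
Qed.

(** A relational form of [bisum]: it carries the convergence of both halves, so the default value of
    [limn] never interferes. *)
Definition has_bisum (a : int -> R) (s : R) : Prop :=
  exists p q, [/\ series (fun n : nat => a n%:Z) @ \oo --> p,
    series (fun n : nat => a (- n.+1%:Z)) @ \oo --> q & s = p + q].

Lemma has_bisumE a s : has_bisum a s -> bisum a = s.
Proof. by case=> p [q [hp hq ->]]; rewrite /bisum (cvg_lim _ hp)// (cvg_lim _ hq). Qed.

(** The term [a 0] moves from the nonnegative half to the negative one. *)
Lemma has_bisum_succ a s : has_bisum a s -> has_bisum (fun k => a (k + 1)) s.
Proof.
case=> p [q [hp hq ->]]; exists (p - a 0), (q + a 0); split.
- have -> : (fun n : nat => a (n%:Z + 1)) = (fun n : nat => a n.+1%:Z).
    by apply/funext => n; congr a; lia.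
  exact: (cvg_series_behead (fun n : nat => a n%:Z) p).1.
- apply/cvg_series_behead; rewrite /= addrK.
  rewrite [X in series X](_ : _ = fun n : nat => a (- n.+1%:Z))//.
  by apply/funext => n; congr a; lia.
- by ring.
Qed.

Lemma has_bisum_pred a s : has_bisum a s -> has_bisum (fun k => a (k - 1)) s.
Proof.
case=> p [q [hp hq ->]]; exists (p + a (-1)), (q - a (-1)); split.
- apply/cvg_series_behead; rewrite /= addrK.
  rewrite [X in series X](_ : _ = fun n : nat => a n%:Z)//.
  by apply/funext => n; congr a; lia.
- have -> : (fun n : nat => a (- n.+1%:Z - 1)) = (fun n : nat => a (- n.+2%:Z)).
    by apply/funext => n; congr a; lia.
  exact: (cvg_series_behead (fun n => a (- n.+1%:Z)) q).1.
- by ring.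
Qed.

Lemma has_bisum_shift a s (m : int) :
  has_bisum a s -> has_bisum (fun k => a (k - m)) s.
Proof.
move=> h; case: m => n.
  elim: n => [|n /has_bisum_pred]; first by under eq_fun do rewrite subr0.
  by congr (has_bisum _ s); apply/funext => k; congr a; lia.
(* [Negz n] stands for [- n.+1], so the base case is already one shift. *)
elim: n => [|n /has_bisum_succ]; first exact: has_bisum_succ.
by congr (has_bisum _ s); apply/funext => k; congr a; lia.
Qed.

End bilateral_sums.

(** * Absolute summability of the kernel at integer powers of e *)

Section kernel_summability.
Variable R : realType.

Lemma esum_lty_series_cvg (T : choiceType) (a : T -> R) (e : nat -> T) :
  (forall k, 0 <= a k) -> injective e ->
  (\esum_(k in [set: T]) (a k)%:E < +oo)%E -> cvgn (series (a \o e)).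
Proof.
move=> a0 ie aoo.
have ub n : ((series (a \o e) n)%:E <= \esum_(k in [set: T]) (a k)%:E)%E.
  rewrite /series /= -sumEFin.
  have ae0 i : (0 <= (a (e i))%:E)%E by rewrite lee_fin.
  apply: (le_trans (nneseries_lim_ge n (fun i _ _ => ae0 i))).
  rewrite nneseries_esumT// -(esum_image setT e (EFin \o a)); last first.
    by move=> i j _ _; exact: ie.
  (* Finite subsets of the range of [e] are among the finite subsets of [T]. *)
  by apply: ereal_sup_le => _ [X [fX XP] <-]; exists X.
apply: nondecreasing_is_cvgn.
  by apply: nondecreasing_series => n _ _; exact: a0.
exists (fine (\esum_(k in [set: T]) (a k)%:E)) => _ [n _ <-].
rewrite -lee_fin fineK// ge0_fin_numE// esum_ge0// => k _.
by rewrite lee_fin.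
Qed.

(** The moment condition is used at [u = 1], where the weight [|k| ^ nu] is at least 1 except at
    [k = 0]. Only [e 0] may be that index, so the first term is set aside and added back at the
    end. *)
Lemma kernel_abs_series_cvg (chi : R -> R) (e : nat -> int) : is_kernel chi ->
  injective e -> (forall n, e n.+1 != 0) ->
  cvgn (series (fun n => `|chi (expR (- (e n)%:~R))|)).
Proof.
move=> [_ _ _ [nu nu0 hs]] ie e0.
pose a (k : int) := `|chi (expR (- k%:~R))| * `|k%:~R : R| `^ nu.
have a0 k : 0 <= a k by rewrite mulr_ge0// powR_ge0.
have aoo : (\esum_(k in [set: int]) (a k)%:E < +oo)%E.
  apply: le_lt_trans hs; apply: ereal_sup_ubound.
  exists 1; first by rewrite /= in_itv /= ltr01.
  by apply: eq_esum => k _; rewrite mulr1 ln1 subr0.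
have ca : cvgn (series (fun n => a (e n.+1))).
  apply: (@esum_lty_series_cvg _ a (fun n => e n.+1)) => //.
  by move=> i j /ie[].
have /cvg_ex[l hl] : cvgn (series (fun n => `|chi (expR (- (e n.+1)%:~R))|)).
  apply: (@series_le_cvg R _ (fun n => a (e n.+1))) => // n.
  have ge1 : 1 <= `|(e n.+1)%:~R : R|.
    by rewrite -intr_norm ler1z -gtz0_ge1 normr_gt0.
  rewrite /a ler_peMr//; apply: le_trans (ler_powR ge1 (ltW nu0)).
  by rewrite powRr0.
apply/cvg_ex; exists (l + `|chi (expR (- (e 0%N)%:~R))|).
by apply/cvg_series_behead; rewrite addrK.
Qed.
End kernel_summability.

(** * Averages over windows shrinking to a point *)

Section averages.
Variable R : realType.
Local Notation mu := (@completed_lebesgue_measure R).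
Implicit Types (f g : R -> R).

Lemma average_bounds (w x c M l U : R) (g : R -> R) : 0 < w ->
  (forall u : R, `|g u| <= M) ->
  (forall u : R, u \in `[x / w, (x + 1) / w] -> u != c -> l <= g u <= U) ->
  l <= w * \int[mu]_(u in `[x / w, (x + 1) / w]) g u <= U.
Proof.
move=> w0 gM glU.
have lt : x / w < (x + 1) / w by rewrite ltr_pM2r ?invr_gt0// ltrDl.
have := Rintegral_itv_bounds lt (fun u _ => gM u) glU.
have -> : (x + 1) / w - x / w = w^-1 by rewrite mulrDl addrC addKr mul1r.
by rewrite ler_pdivlMr// ler_pdivrMr// mulrC.
Qed.

Lemma average_norm_le (w x M : R) (g : R -> R) : 0 < w ->
  (forall u : R, `|g u| <= M) ->
  `|w * \int[mu]_(u in `[x / w, (x + 1) / w]) g u| <= M.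
Proof.
move=> w0 gM; rewrite ler_norml; apply: (average_bounds (c := 0) w0 gM) => u _ _.
by rewrite -ler_norml.
Qed.

(** Meant for [p = w * x] and [q = w * u], with [u] in the window of index [j]: after rescaling by
    [w], its distance to [x] is at most [|j| + 1]. *)
Lemma dist_lt_of_window (p q D j : R) :
  p + j <= q -> q <= p + j + 1 -> `|j| + 1 < D -> `|q - p| < D.
Proof.
have := ler_norm j; have := ler_norm (- j); rewrite normrN ltr_norml.
by move: `|j| => J h1 h2 h3 h4 h5; apply/andP; split; lra.
Qed.

(** The set [S] encodes the side of [x] on which all windows lie, so a one-sided limit of [g]
    suffices. *)
Lemma cvg_average (S : set R) (x j r M : R) (g : R -> R) :
  (forall u : R, `|g u| <= M) ->
  (forall e : R, 0 < e -> exists2 d : R, 0 < d &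
    forall u : R, S u -> u != x -> `|u - x| < d -> `|r - g u| <= e) ->
  (forall w u : R, 0 < w -> u \in `[(w * x + j) / w, (w * x + j + 1) / w] -> S u) ->
  w * \int[mu]_(u in `[(w * x + j) / w, (w * x + j + 1) / w]) g u
    @[w --> +oo] --> r.
Proof.
move=> gM gr uS; apply/cvgrPdist_le => e e0.
have [d d0 hd] := gr e e0.
near=> w.
have w0 : 0 < w by near: w; apply: nbhs_pinfty_gt; exact: num_real.
(* Beyond this threshold the whole window lies within [d] of [x]. *)
have wj : (`|j| + 1) / d < w by near: w; apply: nbhs_pinfty_gt; exact: num_real.
suff : r - e <= w * \int[mu]_(u in `[(w * x + j) / w, (w * x + j + 1) / w]) g u
    <= r + e.
  by rewrite ler_distlC.
apply: (average_bounds (c := x) w0 gM) => u uI ux.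
rewrite -ler_distlC; apply: hd => //; first exact: uS uI.
move: uI wj; rewrite in_itv /= ler_pdivrMr// ler_pdivlMr// ltr_pdivrMr//.
move=> /andP[u1 u2] wj.
have : `|w * (u - x)| < w * d.
  by rewrite mulrBr; apply: (dist_lt_of_window (j := j)); rewrite 1?[w * u]mulrC//.
by rewrite normrM (gtr0_norm w0) ltr_pM2l.
Unshelve. all: by end_near. Qed.

Lemma expR_near (t d : R) : 0 < t -> 0 < d ->
  exists2 d' : R, 0 < d' & forall u : R, `|u - ln t| < d' -> `|expR u - t| < d.
Proof.
move=> t0 d0.
have /cvgrPdist_lt /(_ d d0) [d' /= d'0 h] := @continuous_expR R (ln t).
exists d' => // u ut; rewrite distrC -[X in X - _](lnK t0); apply: h => /=.
by rewrite distrC.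
Qed.

Lemma cvg_average_right f (t j r M : R) : 0 < t -> 0 <= j ->
  (forall x : R, 0 < x -> `|f x| <= M) ->
  f (t + y) @[y --> 0^'+] --> r ->
  w * \int[mu]_(u in `[(w * ln t + j) / w, (w * ln t + j + 1) / w]) f (expR u)
    @[w --> +oo] --> r.
Proof.
move=> t0 j0 fM /cvgrPdist_le fr.
apply: (@cvg_average [set u | ln t <= u] _ _ _ M) => [u|e e0|w u w0].
- by rewrite fM ?expR_gt0.
- have [d /= d0 hd] := fr e e0; have [d' d'0 hd'] := expR_near t0 d0.
  exists d' => // u /= tu ut /hd' ud.
  rewrite -(subrKC t (expR u)); apply: hd; first by rewrite /= sub0r normrN.
  by rewrite subr_gt0 -[ltLHS](lnK t0) ltr_expR lt_neqAle eq_sym ut.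
- rewrite in_itv /= ler_pdivrMr// => /andP[h _] /=.
  by rewrite -(ler_pM2l w0) (mulrC w u) (le_trans _ h)// lerDl.
Qed.

(** With [j <= - 1] even the upper endpoint [ln t + (j + 1) / w] does not exceed [ln t]. *)
Lemma cvg_average_left f (t j r M : R) : 0 < t -> j <= - 1 ->
  (forall x : R, 0 < x -> `|f x| <= M) ->
  f (t - y) @[y --> 0^'+] --> r ->
  w * \int[mu]_(u in `[(w * ln t + j) / w, (w * ln t + j + 1) / w]) f (expR u)
    @[w --> +oo] --> r.
Proof.
move=> t0 j0 fM /cvgrPdist_le fr.
apply: (@cvg_average [set u | u <= ln t] _ _ _ M) => [u|e e0|w u w0].
- by rewrite fM ?expR_gt0.
- have [d /= d0 hd] := fr e e0; have [d' d'0 hd'] := expR_near t0 d0.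
  exists d' => // u /= tu ut /hd' ud.
  rewrite -(subKr t (expR u)); apply: hd.
    by rewrite /= sub0r normrN distrC.
  by rewrite subr_gt0 -[ltRHS](lnK t0) ltr_expR lt_neqAle ut.
- rewrite in_itv /= ler_pdivlMr// => /andP[_ h] /=.
  rewrite -(ler_pM2l w0) (mulrC w u) (le_trans h)//.
  by rewrite -addrA gerDl; lra.
Qed.
End averages.

(** * Limit of the sampling series *)

Section kantorovich_limit.
Variables (R : realType) (chi : R -> R).
Hypothesis hchi : is_kernel chi.
Local Notation bpos := (fun n : nat => chi (expR (- (n%:Z)%:~R))).
Local Notation bneg := (fun n : nat => chi (expR (- (- n.+1%:Z)%:~R))).

Lemma kernel_pos_abs_cvg : cvgn (series (fun n => `|bpos n|)).
Proof. by apply: (kernel_abs_series_cvg hchi) => // i j []. Qed.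

Lemma kernel_neg_abs_cvg : cvgn (series (fun n => `|bneg n|)).
Proof.
by apply: (kernel_abs_series_cvg hchi (e := fun n : nat => - n.+1%:Z)) => [i j|n]; lia.
Qed.

(** As [ln 1 = 0], the sum runs over [k > 0]: it is the nonnegative half without its term [chi 1] at
    [k = 0]. *)
Lemma psi_minus1 : psi_minus chi 1 = limn (series bpos) - chi 1.
Proof.
have /cvg_series_behead hp : series bpos @ \oo --> limn (series bpos).
  exact: normed_cvg kernel_pos_abs_cvg.
apply: has_bisumE; exists (limn (series bpos) - chi 1), 0; split.
- apply/cvg_series_behead; rewrite ln1 ltxx subr0.
  move: hp; rewrite /= oppr0 expR0.
  rewrite (_ : (fun n : nat => if _ then _ else _) = fun n => bpos n.+1)//.
  by apply/funext => n; rewrite ltr0z ltz_nat ltn0Sn mul1r.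
- rewrite (_ : series _ = fun=> 0); first exact: cvg_cst.
  apply/funext => n; rewrite /series /= big1// => i _.
  by rewrite ln1 ltr0z; case: ltP => //; lia.
- by rewrite addr0.
Qed.

Lemma psi_plus1 : psi_plus chi 1 = limn (series bneg).
Proof.
apply: has_bisumE; exists 0, (limn (series bneg)); split.
- rewrite (_ : series _ = fun=> 0); first exact: cvg_cst.
  apply/funext => n; rewrite /series /= big1// => i _.
  by rewrite ln1 ltrz0; case: ltP => //; lia.
- rewrite (_ : (fun n : nat => if _ then _ else _) = bneg).
    exact: normed_cvg kernel_neg_abs_cvg.
  by apply/funext => n; rewrite ln1 ltrz0 mul1r.
- by rewrite add0r.
Qed.

Lemma kernel_sum_at1 : limn (series bpos) + limn (series bneg) = 1.
Proof.
have [_ h] := kernel_sum1 hchi (@ltr01 R); apply: etrans h; rewrite /bisum.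
by congr (limn (series _) + limn (series _)); apply/funext => n; rewrite mulr1.
Qed.

(** This identity alone yields the equivalence of (ii) and (iii). *)
Lemma psi_plus_minus : psi_plus chi 1 = 1 - psi_minus chi 1 - chi 1.
Proof. by rewrite psi_plus1 psi_minus1 -[X in X - _ - _]kernel_sum_at1; ring. Qed.

Local Notation A f t w j :=
  (w * \int[@completed_lebesgue_measure R]_(u in
     `[(w * ln t + j) / w, (w * ln t + j + 1) / w]) f (expR u)).

Lemma kantorovich_at_integer (f : R -> R) (t w M : R) (m : int) :
  0 < t -> 0 < w -> w * ln t = m%:~R ->
  (forall x : R, 0 < x -> `|f x| <= M) ->
  kantorovich chi w f t =
    limn (series (fun n => bpos n * A f t w (n%:Z)%:~R)) +
    limn (series (fun n => bneg n * A f t w (- n.+1%:Z)%:~R)).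
Proof.
move=> t0 w0 wm fM.
have AM j : `|A f t w j| <= M.
  by apply: average_norm_le => // u; rewrite fM// expR_gt0.
(* Bounded averages and an absolutely summable kernel make both halves converge, which the shift by
   [m] requires. *)
have h : has_bisum (fun k : int => chi (expR (- k%:~R)) * A f t w k%:~R)
    (limn (series (fun n => bpos n * A f t w (n%:Z)%:~R)) +
    limn (series (fun n => bneg n * A f t w (- n.+1%:Z)%:~R))).
  exists (limn (series (fun n => bpos n * A f t w (n%:Z)%:~R))).
  exists (limn (series (fun n => bneg n * A f t w (- n.+1%:Z)%:~R))).
  have [_ cp] := cvg_series_weighted (g := fun n : nat => A f t w (n%:Z)%:~R)
    kernel_pos_abs_cvg (fun n => AM _).
  have [_ cn] := cvg_series_weighted (g := fun n : nat => A f t w (- n.+1%:Z)%:~R)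
    kernel_neg_abs_cvg (fun n => AM _).
  by split; [exact: cp|exact: cn|].
rewrite -(has_bisumE (has_bisum_shift m h)) /kantorovich.
congr bisum; apply/funext => k; congr (chi _ * (w * _)).
  (* Since [t] is nonzero, [t] to the power [w] is [expR (w * ln t)], that is [expR m]. *)
  rewrite {1}/powR gt_eqF// wm -expRD; congr expR.
  by rewrite intrB opprB addrC.
by rewrite wm intrB subrKC intrD.
Qed.

Lemma cvg_kantorovich (f : R -> R) (t M : R) (rl ll : R) :
  0 < t -> (forall x : R, 0 < x -> `|f x| <= M) ->
  f (t + y) @[y --> 0^'+] --> rl -> f (t - y) @[y --> 0^'+] --> ll ->
  kantorovich chi w f t
    @[w --> within [set w : R | 0 < w /\
                      exists m : int, w * ln t = m%:~R] (pinfty_nbhs R)]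
    --> rl * limn (series bpos) + ll * limn (series bneg).
Proof.
move=> t0 fM fr fl.
set S := [set w : R | _].
have AM : \forall w \near +oo, forall j, `|A f t w j| <= M.
  near=> w => j; apply: average_norm_le => [|u]; last by rewrite fM// expR_gt0.
  by near: w; apply: nbhs_pinfty_gt; exact: num_real.
(* The recentred series make sense for every [w], so the limit is taken along the full filter at
   infinity; it is restricted afterwards to [S], where they agree with [kantorovich]. *)
have h : limn (series (fun n => bpos n * A f t w (n%:Z)%:~R)) +
    limn (series (fun n => bneg n * A f t w (- n.+1%:Z)%:~R)) @[w --> +oo]
    --> rl * limn (series bpos) + ll * limn (series bneg).
  apply: cvgD; apply: (@dominated_cvg_series _ _ _ _ _ _ _ M).
  - exact: kernel_pos_abs_cvg.
  - by apply: filterS AM => w h n; exact: h.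
  - by move=> n; apply: (cvg_average_right t0 _ fM fr); rewrite ler0z.
  - exact: kernel_neg_abs_cvg.
  - by apply: filterS AM => w h n; exact: h.
  - move=> n; apply: (cvg_average_left t0 _ fM fl).
    by rewrite -[-1]/((-1)%:~R) ler_int; lia.
have FF : Filter (pinfty_nbhs R) by exact: filter_filter.
have {}h := cvg_trans (cvg_app _ (@cvg_within _ _ FF S)) h.
apply: cvg_trans h; apply: near_eq_cvg.
rewrite near_withinE; apply: filterE => w [w0 [m wm]].
by rewrite (kantorovich_at_integer t0 w0 wm fM).
Unshelve. all: by end_near. Qed.
End kantorovich_limit.

(** Uniqueness of the limit in (i) rests on this: admissible [w] are arbitrarily large. For [a = 0]
    any positive [w] works; otherwise take [n / |a|], with integer [n * sgz a]. *)
Lemma within_integer_multiples_proper (R : realType) (a : R) :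
  ProperFilter (within [set w : R | 0 < w /\
    exists m : int, w * a = m%:~R] (pinfty_nbhs R)).
Proof.
split; last exact: within_filter.
move=> [M [_ h]].
have [a0|a0] := eqVneq a 0.
  apply: (h (`|M| + 1)); first by rewrite ltr_pwDr// ler_norm.
  by split; [rewrite ltr_wpDl|exists 0; rewrite a0 mulr0].
have na : 0 < `|a| by rewrite normr_gt0.
pose n := (Num.truncn (`|a| * `|M|)).+1.
have nM : `|M| < n%:R / `|a| by rewrite ltr_pdivlMr// mulrC truncnS_gt.
apply: (h (n%:R / `|a|)); first by rewrite (le_lt_trans _ nM)// ler_norm.
split; first by rewrite divr_gt0// ltr0n.
exists (n%:Z * sgz a); rewrite intrM -sgrEz mulrAC -mulrA; congr (_ * _).
by rewrite [X in X / _]numEsg mulfK// gt_eqF.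
Qed.

Theorem theorem2 (R : realType) (chi f : R -> R) (t alpha : R)
    (hchi : is_kernel chi)
    (hfm : lebesgue_measurable_fun `]0, +oo[ f)
    (hfb : [bounded f x | x in `]0, +oo[])
    (ht : 0 < t)
    (hjump : jump_discontinuity f t) :
  ((kantorovich chi w f t
      @[w --> within [set w : R | 0 < w /\
                        exists m : int, w * ln t = m%:~R] (pinfty_nbhs R)]
      --> (chi 1 + alpha) * right_limit f t
          + (1 - alpha - chi 1) * left_limit f t)
   <-> psi_minus chi 1 = alpha)
  /\ (psi_minus chi 1 = alpha <-> psi_plus chi 1 = 1 - alpha - chi 1).
Proof.
have psiE := psi_plus_minus hchi.
split; last by rewrite psiE; split=> h; lra.
case: hjump => cr cl rl.
have [M fM] : exists M : R, forall x : R, 0 < x -> `|f x| <= M.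
  (* [hM] bounds [f] by every constant strictly above [M], hence [M + 1]. *)
  case: hfb => M [_ hM]; exists (M + 1) => x x0.
  by apply: (hM (M + 1)); rewrite ?ltrDl//= in_itv /= x0.
have FF := within_integer_multiples_proper (ln t).
have := cvg_kantorovich hchi ht fM cr cl.
rewrite -/(right_limit f t) -/(left_limit f t) -(psi_plus1 hchi) psiE.
rewrite (_ : limn _ = chi 1 + psi_minus chi 1); last first.
  by rewrite (psi_minus1 hchi) subrKC.
(* From (ii) to (i), [K] is the claim up to rearrangement. Conversely, [K] and [K'] give two limits
   along a proper filter, and the jump [rl] excludes the second factor of their difference. *)
move=> K; split=> [K'|<-]; last first.
  move: K; rewrite [right_limit f t * _]mulrC [left_limit f t * _]mulrC.
  by rewrite [1 - _ - _]addrAC.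
have /eqP := @cvg_unique _ (@Rhausdorff R) _ (fmap_proper_filter _ FF) _ _ K K'.
rewrite -subr_eq0.
rewrite (_ : _ - _ =
  (psi_minus chi 1 - alpha) * (right_limit f t - left_limit f t)); last by ring.
by rewrite mulf_eq0 !subr_eq0 => /orP[/eqP//|/eqP].
Qed.
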